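(* Let $\mathcal H$ be a real Hilbert space and let $\Phi:\mathcal H\to\mathbb R$ be a convex continuously differentiable function such that $\operatorname{argmin}\Phi$ is nonempty. Let $t_0>0$, $\alpha>3$, and let $g:[t_0,+\infty[\to\mathcal H$ satisfy $\int_{t_0}^{+\infty}t\|g(t)\|\,dt<+\infty$. Let $x:[t_0,+\infty[\to\mathcal H$ be a classical solution of $$\ddot x(t)+\frac{\alpha}{t}\dot x(t)+\nabla\Phi(x(t))=g(t).$$ Then the following hold: a) (weak convergence) There exists some $x^*\in\operatorname{argmin}\Phi$ such that $x(t)\rightharpoonup x^*$ weakly in $\mathcal H$ as $t\to+\infty$. b) (fast convergence) There exists a positive constant $C$ such that $$\Phi(x(t))-\min_{\mathcal H}\Phi\le\frac{C}{t^2}\quad\text{for all } t\ge t_0,\qquad\text{and}\qquad \int_{t_0}^{\infty}t\left(\Phi(x(t))-\inf_{\mathcal H}\Phi\right)dt<+\infty .$$ c) (energy estimate) $$\int_{t_0}^{\infty}t\|\dot x(t)\|^2\,dt<+\infty,$$ there exists a positive constant $C$ such that $\|\dot x(t)\|\le\frac{C}{t}$ for all $t\ge t_0$, and hence $\lim_{t\to\infty}\|\dot x(t)\|=0$.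
   Context: $\|\cdot\|$ is the norm of $\mathcal H$ associated with its scalar product. *)

(* Defs.v *)
From HB Require Import structures.
From mathcomp Require Import all_boot all_order all_algebra.
From mathcomp Require Import all_classical all_reals all_analysis.

Set Implicit Arguments.
Unset Strict Implicit.
Unset Printing Implicit Defensive.

Import Order.TTheory GRing.Theory Num.Theory.
Import numFieldNormedType.Exports.

Local Open Scope classical_set_scope.
Local Open Scope ring_scope.

(* A real Hilbert space is a complete normed module [H] over [R : realType]
   together with a scalar product [dot : {dot H for idfun}] (symmetric,
   bilinear, positive definite) inducing its norm. *)
Definition norm_of_dot (R : realType) (H : completeNormedModType R)
    (dot : {dot H for idfun}) : Prop :=
  forall u : H, `|u| = Num.sqrt (dot u u).

Definition is_gradient (R : realType) (H : completeNormedModType R)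
    (dot : {dot H for idfun}) (Phi : H -> R) (gradPhi : H -> H) : Prop :=
  forall u : H, is_diff u (Phi : H -> R^o) (fun h => dot (gradPhi u) h : R^o).

Definition argmin (T : Type) (R : realType) (f : T -> R) : set T :=
  [set u | forall v, f u <= f v].

Definition weakly_cvg (R : realType) (H : completeNormedModType R)
    (dot : {dot H for idfun}) (x : R -> H) (F : set_system R) (l : H) : Prop :=
  forall y : H, dot (x t) y @[t --> F] --> dot l y.

(* Derivatives of a curve defined on a subset [D] of the line: the difference
   quotient is only taken at points of [D], so that at the left endpoint of
   [D = `[t0, +oo[] one gets the right derivative, and the (junk) values of the
   total function [x] outside [D] play no role. *)
Definition derivable_within (R : realType) (H : normedModType R)
    (D : set R) (x : R -> H) (t : R) : Prop :=
  cvg ((s - t)^-1 *: (x s - x t) @[s --> within D t^']).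

Definition derive_within (R : realType) (H : normedModType R)
    (D : set R) (x : R -> H) (t : R) : H :=
  lim ((s - t)^-1 *: (x s - x t) @[s --> within D t^']).

(* The derivatives occurring in the equation exist, and the equation holds, at
   every point of [[t0, +oo[] (not merely almost everywhere). Continuity of the
   second derivative is not required; it amounts to continuity of [g]. *)
Definition classical_solution (R : realType) (H : completeNormedModType R)
    (gradPhi : H -> H) (t0 alpha : R) (g x : R -> H) : Prop :=
  let I := `[t0, +oo[%classic in
  let dx := derive_within I x in
  let ddx := derive_within I dx in
  forall t, t0 <= t ->
    [/\ derivable_within I x t, derivable_within I dx t &
        ddx t + (alpha / t) *: dx t + gradPhi (x t) = g t].

(* Main.v *)
Require Import Defs.
From HB Require Import structures.
From mathcomp Require Import all_boot all_order all_algebra.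
From mathcomp Require Import all_classical all_reals all_analysis.
From mathcomp Require Import measurable_realfun ring lra.

(** With [m = min Phi], a minimizer [z] and [v = (alpha - 1) (x - z) + t x'],
    the energies
      E = t^2 (Phi(x) - m) + |v|^2 / 2   and   Y = t^2 (Phi(x) - m + |x'|^2 / 2)
    satisfy
      E' <= - (alpha - 3) t (Phi(x) - m) + t <v, g>,
      Y'  = 2 t (Phi(x) - m) - (alpha - 1) t |x'|^2 + t^2 <x', g>,
    so a logarithmic Gronwall argument bounds them, and integrating gives the
    integrability claims. Moreover [Y] converges and [Y / t] is integrable,
    hence [Y --> 0]; since [E] converges too, so does [|x - z|], and Opial's
    argument applies. The weak cluster points are taken along ultrafilters,
    which needs no separability.

    Neither [x''] nor [g] is assumed continuous, so that [E] and [Y] are merely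
    differentiable with derivative bounded by an integrable [p]. That
    [F b - F a <= int_a^b p] still holds is proved by approximating [p] from
    above as in the Vitali-Caratheodory theorem. *)

Set Implicit Arguments.
Unset Strict Implicit.
Unset Printing Implicit Defensive.
Import Order.TTheory GRing.Theory Num.Theory.
Import numFieldNormedType.Exports.
Local Open Scope classical_set_scope.
Local Open Scope ring_scope.

(** * An integral bound for functions with dominated derivative *)

(** A lower semicontinuous majorant: [u] is a countable sum of multiples of indicators of open sets.
    Its local bound by some [c > p t] is what turns a derivative bound at the single point [t] into
    a comparison on a neighbourhood. *)
Lemma integrable_upper_approx (R : realType) (D : set R) (p : R -> R) (e : R) :
  measurable D -> (@lebesgue_measure R D < +oo)%E ->
  measurable_fun D p -> (forall t, D t -> 0 <= p t) -> 0 < e ->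
  exists u : R -> \bar R,
    [/\ measurable_fun setT u, forall t, (0 <= u t)%E,
        forall t, D t -> exists2 c, p t < c & \forall s \near t, (c%:E <= u s)%E &
        (\int[@lebesgue_measure R]_(t in D) u t <=
         \int[@lebesgue_measure R]_(t in D) (p t)%:E + e%:E)%E].
Proof.
move=> mD Doo mp p0 e0; set mu := @lebesgue_measure R.
set T := measurableTypeR R.
have {}mD : measurable (D : set T) by [].
have {}mp : measurable_fun (D : set T) p by [].
have muD : mu D \is a fin_num by rewrite ge0_fin_numE.
(* Rounding [p] up to multiples of [d] costs [d * mu D], and enlarging the level sets to open sets
   costs [d] in total; with this [d] the two costs add up to [e]. *)
set d := e / (fine (mu D) + 1).
have D1 : 0 < fine (mu D) + 1 by rewrite ltr_pwDr ?fine_ge0.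
have d0 : 0 < d by rewrite divr_gt0.
pose A n := D `&` [set t | n%:R * d <= p t].
have mA n : measurable (A n : set T).
  rewrite /A (_ : [set t | _] = p @^-1` `[n%:R * d, +oo[); first exact: mp.
  by apply/seteqP; split => t /=; rewrite in_itv/= andbT.
have muA n : (mu (A n) < +oo)%E.
  by apply: le_lt_trans Doo; apply: le_measure; rewrite ?inE//; exact: subIsetl.
have /choice[V VP] : forall n, exists U : set R,
    [/\ open U, A n `<=` U & (mu (U `\` A n) < (1 / (2 ^ n.+1)%:R)%:E)%E].
  by move=> n; apply: (lebesgue_regularity_outer (mA n) (muA n)); rewrite divr_gt0// ltr0n expn_gt0.
have oO n : open (V n) by have [] := VP n.
have mO n : measurable (V n : set T).
  exact: open_measurable (oO n).
have AO n : A n `<=` V n by have [] := VP n.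
have muO n : (mu (V n) <= mu (A n) + (1 / (2 ^ n.+1)%:R)%:E)%E.
  rewrite -{1}(setDUK (AO n)).
  rewrite (le_trans (measureU2 _ _ _))//; first exact: measurableD.
  by rewrite leeD2l// ltW//; case: (VP n).
have dI0 (U : set R) t : (0 <= (d * \1_U t)%:E)%E.
  by rewrite lee_fin mulr_ge0 ?(ltW d0)// indicE ler0n.
(* Layer cake: [d] times the number of [n] with [n d <= p t] lies between [p t]
   and [p t + d]; the open sets [V n] replace the level sets [A n]. *)
pose u t := (\sum_(0 <= n <oo) (d * \1_(V n) t)%:E)%E.
have mdI (E U : set T) : measurable U -> measurable_fun E (fun t => (d * \1_U t)%:E).
  by move=> mU; apply/measurable_EFinP; apply: measurable_funM.
have intI (U : set T) : measurable U ->
    (\int[mu]_(t in D) (d * \1_U t)%:E = d%:E * mu (U `&` D))%E.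
  move=> mU; under eq_integral do rewrite EFinM.
  rewrite ge0_integralZl//= ?integral_indic ?lee_fin ?(ltW d0)//.
  by apply/measurable_EFinP.
exists u; split.
- apply: (@ge0_emeasurable_sum _ _ R setT (fun n t => (d * \1_(V n) t)%:E) xpredT) => //.
  by move=> n _; exact: mdI.
- by move=> t; exact: nneseries_ge0.
- move=> t Dt; have pd0 : 0 <= p t / d by rewrite divr_ge0 ?p0// ltW.
  (* The point [t] lies in [A n] for every [n < N], so a neighbourhood of [t] lies in all [N] open
     sets [V n], where [u] is at least [N d > p t]. *)
  pose N := (Num.trunc (p t / d)).+1.
  have ptN : p t < N%:R * d.
    by rewrite -ltr_pdivrMr//; have /andP[] := truncn_itv pd0.
  have tO n : (n < N)%N -> V n t.
    rewrite /N ltnS truncn_ge_nat// ler_pdivlMr// => nt.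
    by apply: (AO n); split.
  exists (N%:R * d) => //.
  have : \forall s \near t, forall n : 'I_N, V n s.
    apply: (@filter_forall R _ (fun n : 'I_N => V n) (nbhs t)) => n.
    apply: open_nbhs_nbhs; split => //.
    exact: tO.
  apply: filterS => s sO.
  rewrite (le_trans _ (nneseries_lim_ge N _))// big_mkord sumEFin lee_fin.
  rewrite (eq_bigr (fun=> d)) => [|n _]; last first.
    by rewrite indicE mem_set ?mulr1//; exact: sO.
  by rewrite sumr_const card_ord mulr_natl.
- rewrite integral_nneseries//; last by move=> n; exact: mdI.
  apply: (@le_trans _ _ (\sum_(0 <= n <oo) (d%:E * mu (A n) + (d / (2 ^ n.+1)%:R)%:E))%E).
    apply: lee_nneseries => n _; first by move=> _; exact: integral_ge0.
    rewrite intI// (_ : (d / _)%:E = (d%:E * (1 / (2 ^ n.+1)%:R)%:E)%E); last first.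
      by rewrite -EFinM mulrA mulr1.
    rewrite -ge0_muleDr; [|exact: measure_ge0|by rewrite lee_fin divr_ge0].
    apply: lee_wpmul2l; first by rewrite lee_fin ltW.
    rewrite (le_trans _ (muO n))// le_measure ?inE//.
    exact: measurableI.
  apply: (le_trans (epsilon_trick _ _ (ltW d0))).
    by move=> n; apply: mule_ge0; rewrite ?lee_fin ?(ltW d0).
  apply: (@le_trans _ _ (\int[mu]_(t in D) (p t)%:E + (d * fine (mu D))%:E + d%:E)%E); last first.
    rewrite -addeA leeD2l// -EFinD lee_fin -{2}(mulr1 d) -mulrDr /d.
    by rewrite divfK// gt_eqF.
  rewrite leeD2r//.
  rewrite (eq_eseriesr (g := fun n => \int[mu]_(t in D) (d * \1_(A n) t)%:E))%E; last first.
    by move=> n _; rewrite intI// setIidl//; exact: subIsetl.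
  rewrite -integral_nneseries//; last by move=> n; exact: mdI.
  rewrite EFinM fineK// -integral_cst// -ge0_integralD//=; last 2 first.
  - exact/measurable_EFinP.
  - by move=> t _; rewrite lee_fin ltW.
  apply: ge0_le_integral => //.
  - by move=> t _; exact: nneseries_ge0.
  - apply: (@ge0_emeasurable_sum _ _ R D (fun n t => (d * \1_(A n) t)%:E) xpredT) => //.
    by move=> n _; exact: mdI.
  - by apply/measurable_EFinP; exact: measurable_funD.
  move=> t Dt; apply: lime_le; first exact: is_cvg_nneseries.
  apply: nearW => N; rewrite big_mkord sumEFin lee_fin.
  (* The bound by [N d] is carried along for the induction: when [t] is in [A N], the earlier terms
     sum to at most [N d <= p t], and one more term adds [d]. *)
  suff: \sum_(i < N) d * \1_(A i) t <= p t + d /\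
        \sum_(i < N) d * \1_(A i) t <= N%:R * d by case.
  elim: N => [|N [IH1 IH2]].
    by rewrite big_ord0 mul0r addr_ge0 ?p0// ltW.
  rewrite big_ord_recr/= indicE; have [/[!inE] AN|] := boolP (t \in A N).
    rewrite mulr1; split; last by rewrite -natr1 mulrDl mul1r lerD2r.
    by rewrite lerD2r (le_trans IH2)//; case: AN.
  rewrite mulr0 addr0 => _; split => //; rewrite (le_trans IH2)//.
  by rewrite ler_wpM2r ?(ltW d0)// ler_nat.
Qed.

(** Continuous induction: the supremum of the points up to which [P] holds inherits [P] from the
    left, and if it lay below [b] the right step would push it further. *)
Lemma real_induction (R : realType) (a b : R) (P : R -> Prop) : a <= b ->
  P a ->
  (forall t, a <= t < b -> P t -> \forall s \near t^'+, P s) ->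
  (forall t, a < t <= b -> (forall s, a <= s < t -> P s) -> P t) ->
  P b.
Proof.
move=> ab Pa Pr Pl.
pose S := [set t | a <= t <= b /\ forall s, a <= s <= t -> P s].
have Sa : S a.
  by split=> [|s]; rewrite ?lexx ?ab// => /andP[? ?]; rewrite (@le_anti _ _ s a)//; apply/andP.
have supS : has_sup S.
  by split; [exists a|exists b => t [/andP[]]].
set m := sup S.
have am : a <= m by apply: ub_le_sup => //; case: supS.
have mb : m <= b by apply: ge_sup; [exists a|move=> t [/andP[]]].
have Pltm s : a <= s < m -> P s.
  move=> /andP[as_]; rewrite -subr_gt0 => sm.
  have [t [_ tP]] := sup_adherent sm supS.
  by rewrite subKr => /ltW st; apply: tP; rewrite as_.
have Pm : P m.
  have [am'|] := ltP a m; first by apply: Pl; rewrite ?am' ?mb.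
  by move=> ma; rewrite (@le_anti _ _ m a)// ma am.
have [mb'|bm] := ltP m b; last by rewrite (@le_anti _ _ b m)// bm mb.
have /Pr/(_ Pm) : a <= m < b by rewrite am mb'.
rewrite nearE => -[/= e e0 eP].
pose t := m + Num.min (e / 2) (b - m).
have mt : m < t by rewrite ltrDl lt_min divr_gt0//= subr_gt0.
have tm2 : t <= m + e / 2 by rewrite lerD2l ge_min lexx.
have tb : t <= b by rewrite -lerBrDl ge_min lexx orbT.
have : S t.
  split=> [|s /andP[as_ st]]; first by rewrite (le_trans am (ltW mt)).
  have [sm|ms|<-//] := ltgtP m s; last by apply: Pltm; rewrite as_.
  apply: eP => //=; rewrite ltr0_norm ?subr_lt0// opprB ltrBlDl.
  rewrite (le_lt_trans st)// (le_lt_trans tm2)// ltrD2l ltr_pdivrMr// ltr_pMr//.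
  by rewrite ltr1n.
by move=> /(ub_le_sup supS.2); rewrite leNgt mt.
Qed.

Lemma is_derive_near_right_le (R : realType) (F : R -> R) (t d c : R) :
  is_derive t 1 F d -> d < c -> \forall s \near t^'+, F s - F t <= c * (s - t).
Proof.
move=> [dF dE] dc.
have : h^-1 *: ((F \o shift t) h%:A - F t) @[h --> 0^'] --> d.
  by rewrite -dE; exact: dF.
move=> /cvgr_lt/(_ _ dc); rewrite !nearE => -[/= e e0 eP].
exists e => //= s ste ts.
have st0 : 0 < s - t by rewrite subr_gt0.
have /= := eP (s - t); rewrite sub0r normrN distrC => /(_ ste).
rewrite gt_eqF// => /(_ isT).
by rewrite [(s - t)%:A]mulr1 subrK /GRing.scale/= ltr_pdivrMl// mulrC => /ltW.
Qed.

(** With [u] above [p] and [G s] its integral over []a, s]], continuous induction propagates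
    [F t <= F a + e / 2 + G t]: near [t] the increments of [F] are at most [c (s - t)] for some [c]
    between [p t] and [u], while those of [G] are at least that. No measurability of [f] is
    involved. *)
Lemma le_integral_of_derive_le (R : realType) (F f p : R -> R) (a b : R) :
  a <= b -> (forall t, a <= t <= b -> {for t, continuous F}) ->
  (forall t, a < t < b -> is_derive t 1 F (f t)) ->
  (forall t, a < t < b -> f t <= p t) ->
  (forall t, a <= t <= b -> 0 <= p t) ->
  (@lebesgue_measure R).-integrable `[a, b] (EFin \o p) ->
  ((F b - F a)%:E <= \int[@lebesgue_measure R]_(t in `[a, b]) (p t)%:E)%E.
Proof.
move=> ab cF dF fp p0 intp.
set mu := @lebesgue_measure R.
have muab : (mu `[a, b]%classic < +oo)%E.
  by rewrite /mu lebesgue_measure_itv/=; case: ifP => _; rewrite ?ltry.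
have mp : measurable_fun `[a, b] p.
  by apply/measurable_EFinP; exact: (measurable_int mu intp).
have Ip : (\int[mu]_(t in `[a, b]) (p t)%:E)%E \is a fin_num.
  by apply: integrable_fin_num => //; exact: measurable_itv.
rewrite -(fineK Ip) lee_fin; apply/ler_addgt0Pr => e e0.
have e20 : 0 < e / 2 by rewrite divr_gt0.
have [u [mu_ u0 up uint]] := @integrable_upper_approx R `[a, b] p (e / 2)
  (measurable_itv _) muab mp (fun t tab => p0 t tab) e20.
have mu' (D : set R) : measurable_fun D u by exact: measurable_funS mu_.
pose G s := (\int[mu]_(t in `]a, s]) u t)%E.
have Gab s : s <= b -> (G s <= (fine (\int[mu]_(t in `[a, b]) (p t)%:E) + e / 2)%:E)%E.
  move=> sb; rewrite EFinD fineK// (le_trans _ uint)//.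
  apply: ge0_subset_integral; [exact: measurable_itv|exact: measurable_itv|
    exact: mu'|by move=> t _; exact: u0|move=> t /=].
  rewrite !in_itv/= => /andP[/ltW -> ts].
  exact: le_trans ts sb.
have Gfin s : s <= b -> G s \is a fin_num.
  move=> sb; rewrite ge0_fin_numE; last exact: integral_ge0.
  by rewrite (le_lt_trans (Gab _ sb))// ltry.
have Gle t s c : a <= t -> t <= s -> s <= b -> 0 <= c ->
    (forall r, t < r <= s -> (c%:E <= u r)%E) ->
    fine (G t) + c * (s - t) <= fine (G s).
  move=> at_ ts sb c0 cu.
  rewrite -lee_fin EFinD !fineK ?Gfin ?(le_trans ts)//.
  rewrite /G (@itv_bndbnd_setU _ _ (BRight a) (BRight t) (BRight s))//.
  rewrite ge0_integral_setU; [|exact: measurable_itv|exact: measurable_itv|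
    exact: mu'|by move=> r _; exact: u0|]; last first.
    apply/disj_setPS => r [] /=; rewrite !in_itv/= => /andP[_ rt] /andP[tr _].
    by have := lt_le_trans tr rt; rewrite ltxx.
  rewrite leeD2l//.
  have -> : ((c * (s - t))%:E = \int[mu]_(r in `]t, s]) (cst c%:E r))%E.
    rewrite integral_cst//= /mu lebesgue_measure_itv/= lte_fin.
    move: ts; rewrite le_eqVlt => /orP[/eqP->|->]; last by rewrite -EFinD -EFinM.
    by rewrite ltxx subrr mulr0 mule0.
  apply: ge0_le_integral; [exact: measurable_itv|by move=> r _; rewrite lee_fin|
    exact: measurable_cst|exact: mu'|].
  by move=> r /=; rewrite in_itv => /cu.
have G0 s : a <= s -> s <= b -> 0 <= fine (G s).
  by move=> *; rewrite fine_ge0// integral_ge0.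
have Gmono t s : a <= t -> t <= s -> s <= b -> fine (G t) <= fine (G s).
  move=> at_ ts sb; have := Gle t s 0 at_ ts sb (lexx _).
  by rewrite mul0r addr0; apply => r _.
suff : F b <= F a + e / 2 + fine (G b).
  have := Gab b (lexx _); rewrite -(fineK (Gfin _ (lexx _))) lee_fin.
  by lra.
apply: (@real_induction R a b (fun t => F t <= F a + e / 2 + fine (G t))) => //.
- by rewrite -addrA lerDl addr_ge0 ?G0// ltW.
- move=> t /andP[at_ tb] Ft.
  (* At [a] only continuity of [F] is available, so the first step is paid for by the slack [e / 2];
     the other half of [e] is the excess of the integral of [u]. *)
  move: at_; rewrite le_eqVlt => /orP[/eqP at_|at_].
    have Fte : \forall s \near t^'+, F s < F t + e / 2.
      by apply: cvg_within; apply: (cvgr_lt _ (cF t _)); rewrite ?ltrDl// -at_ lexx.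
    near=> s.
    have ts : t < s by near: s; exact: nbhs_right_gt.
    have sb : s <= b by near: s; exact: nbhs_right_le.
    have Fs : F s < F t + e / 2 by near: s.
    have := G0 s; rewrite -at_ in Fs ts *; move=> /(_ (ltW ts) sb).
    by lra.
  have tab : a < t < b by rewrite at_.
  have /up[c pc cu] : [set` `[a, b]] t by rewrite /= in_itv/= !ltW.
  have c0 : 0 <= c by rewrite (le_trans _ (ltW pc))// p0// !ltW.
  have FtP := is_derive_near_right_le (dF t tab) (le_lt_trans (fp t tab) pc).
  have /nbhs_ballP[r /= r0 rP] := cu.
  near=> s.
  have ts : t < s by near: s; exact: nbhs_right_gt.
  have sb : s <= b by near: s; exact: nbhs_right_le.
  have Fs : F s - F t <= c * (s - t) by near: s.
  have sr : s - t < r by near: s; exact: nbhs_right_ltDr.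
  have qP : forall q, t < q <= s -> (c%:E <= u q)%E.
    move=> q /andP[tq qs]; apply: rP; rewrite /ball/= ltr0_norm ?subr_lt0//.
    by rewrite opprB (le_lt_trans _ sr)// lerD2r.
  by have := Gle t s c (ltW at_) (ltW ts) sb c0 qP; lra.
- move=> t /andP[at_ tb] Ft.
  have Fs : \forall s \near t^'-, F s <= F a + e / 2 + fine (G t).
    near=> s.
    have ts : s < t by near: s; exact: nbhs_left_lt.
    have as_ : a <= s by near: s; exact: nbhs_left_ge.
    by rewrite (le_trans (Ft s _)) ?as_// lerD2l Gmono// ltW.
  have cFt : F s @[s --> t^'-] --> F t by apply: cvg_at_left_filter; apply: cF; rewrite (ltW at_).
  exact: (cvgr_to_le cFt Fs).
Unshelve. all: by end_near. Qed.

(** * Growth dominated by an integrable rate: the inequality [F' <= p] in integrated form *)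

Definition dominated_growth (R : realType) (F p : R -> R) (a : R) :=
  forall s t, a <= s -> s <= t ->
    F t - F s <= \int[@lebesgue_measure R]_(r in `[a, t]) p r -
                 \int[@lebesgue_measure R]_(r in `[a, s]) p r.

Section growth.
Context (R : realType).
Implicit Types (F f p c : R -> R) (a : R).
Notation mu := (@lebesgue_measure R).

Lemma derive_le_dominated_growth F f p a :
  (forall t, a <= t -> {for t, continuous F}) ->
  (forall t, a < t -> is_derive t 1 F (f t)) ->
  (forall t, a < t -> f t <= p t) ->
  (forall t, a <= t -> 0 <= p t) ->
  mu.-integrable `[a, +oo[ (EFin \o p) ->
  dominated_growth F p a.
Proof.
move=> cF dF fp p0 ip s t as_ st.
have ipst (x y : itv_bound R) : (BLeft a <= x)%O ->
    mu.-integrable [set` Interval x y] (EFin \o p).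
  move=> ax; apply: (integrableS _ _ _ ip); [exact: measurable_itv|exact: measurable_itv|].
  by apply: subset_itv => //; case: y => [[]|[]].
rewrite Rintegral_itvB ?bnd_simp//; last exact: ipst.
rewrite Rintegral_itv_obnd_cbnd; last by apply: ipst; rewrite bnd_simp.
rewrite -lee_fin /Rintegral fineK; last first.
  by apply: integrable_fin_num; [exact: measurable_itv|apply: ipst; rewrite bnd_simp].
apply: (@le_integral_of_derive_le _ F f p s t) => //.
- by move=> r /andP[sr _]; apply: cF; rewrite (le_trans as_).
- by move=> r /andP[sr _]; apply: dF; rewrite (le_lt_trans as_).
- by move=> r /andP[sr _]; apply: fp; rewrite (le_lt_trans as_).
- by move=> r /andP[sr _]; apply: p0; rewrite (le_trans as_).
- by apply: ipst; rewrite bnd_simp.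
Qed.

Lemma Rintegral_itv_nondecreasing p a (y z : itv_bound R) :
  (forall t, a <= t -> 0 <= p t) -> mu.-integrable `[a, +oo[ (EFin \o p) ->
  (y <= z)%O ->
  \int[mu]_(r in [set` Interval (BLeft a) y]) p r <=
  \int[mu]_(r in [set` Interval (BLeft a) z]) p r.
Proof.
move=> p0 ip yz.
have ipb (w : itv_bound R) : mu.-integrable [set` Interval (BLeft a) w] (EFin \o p).
  apply: (integrableS _ _ _ ip); [exact: measurable_itv|exact: measurable_itv|].
  by apply: subset_itvl; case: w => [[]|[]].
rewrite /Rintegral fine_le//.
- by apply: integrable_fin_num; [exact: measurable_itv|exact: ipb].
- by apply: integrable_fin_num; [exact: measurable_itv|exact: ipb].
apply: ge0_subset_integral; [exact: measurable_itv|exact: measurable_itv|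
  exact: measurable_int (ipb _)| |].
- by move=> r /=; rewrite in_itv/= lee_fin => /andP[/p0].
- exact: subset_itvl.
Qed.

Lemma dominated_growth_bounded F p a :
  (forall t, a <= t -> 0 <= p t) -> mu.-integrable `[a, +oo[ (EFin \o p) ->
  dominated_growth F p a ->
  exists2 M, 0 <= M & forall t, a <= t -> F t <= M.
Proof.
move=> p0 ip Fp; exists (`|F a| + \int[mu]_(r in `[a, +oo[) p r).
  by rewrite addr_ge0// Rintegral_ge0// => r /=; rewrite in_itv/= => /andP[/p0].
move=> t at_; have := Fp a t (lexx _) at_.
have : \int[mu]_(r in `[a, t]) p r <= \int[mu]_(r in `[a, +oo[) p r.
  exact: Rintegral_itv_nondecreasing.
have : 0 <= \int[mu]_(r in `[a, a]) p r.
  by apply: Rintegral_ge0 => r /=; rewrite in_itv/= => /andP[/p0].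
by have := ler_norm (F a); lra.
Qed.

Lemma nondecreasing_bounded_cvgy F a M :
  (forall s t, a <= s -> s <= t -> F s <= F t) ->
  (forall t, a <= t -> F t <= M) -> exists l : R, F t @[t --> +oo] --> l.
Proof.
move=> F_mono FM; pose H t := F (Num.max a t).
exists (sup (range H)).
have HF : {near +oo, H =1 F}.
  near=> t; rewrite /H (_ : Num.max a t = t)//; apply/max_idPr.
  by near: t; apply: nbhs_pinfty_ge; rewrite num_real.
apply: cvg_trans (near_eq_cvg HF) _.
apply: nondecreasing_cvgr => [s t st|].
  by apply: F_mono; [rewrite le_max lexx|rewrite ge_max !le_max lexx st !orbT].
by exists M => _ [t _ <-]; apply: FM; rewrite le_max lexx.
Unshelve. all: by end_near. Qed.

(** With [G] the primitive of [p], both [G] and [G - F] are nondecreasing and bounded above, hence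
    converge, and [F] is their difference. *)
Lemma dominated_growth_cvg F p a m :
  (forall t, a <= t -> 0 <= p t) -> mu.-integrable `[a, +oo[ (EFin \o p) ->
  dominated_growth F p a -> (forall t, a <= t -> m <= F t) ->
  exists l : R, F t @[t --> +oo] --> l.
Proof.
move=> p0 ip Fp mF; pose G t := \int[mu]_(r in `[a, t]) p r.
have Gle t : a <= t -> G t <= \int[mu]_(r in `[a, +oo[) p r.
  by move=> _; exact: Rintegral_itv_nondecreasing.
have [k Gk] : exists l : R, G t @[t --> +oo] --> l.
  apply: (nondecreasing_bounded_cvgy _ Gle) => s t as_ st.
  by apply: Rintegral_itv_nondecreasing => //; rewrite bnd_simp.
have [l Gl] : exists l : R, (G \- F) t @[t --> +oo] --> l.
  apply: (@nondecreasing_bounded_cvgy _ a (\int[mu]_(r in `[a, +oo[) p r - m)).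
    by move=> s t as_ st /=; have := Fp s t as_ st; rewrite -/(G s) -/(G t); lra.
  by move=> t at_ /=; have := Gle t at_; have := mF t at_; lra.
exists (k - l); suff -> : F = G - (G \- F) by exact: cvgB Gk Gl.
by apply/funext => t; rewrite !fctE/= subKr.
Qed.

(** This extracts integrability from dissipation: [F + C], with [C] a primitive of [c], has growth
    dominated by [p], so it is bounded above; as [F >= 0], so is the nondecreasing [C], whose limit
    gives the improper integral of [c]. *)
Lemma derive_add_le_integrable F f c p a :
  (forall t, a <= t -> {for t, continuous F}) ->
  (forall t, a < t -> is_derive t 1 F (f t)) ->
  (forall t, a < t -> f t + c t <= p t) ->
  (forall t, a <= t -> 0 <= F t) -> continuous c ->
  (forall t, a <= t -> 0 <= c t) -> (forall t, a <= t -> 0 <= p t) ->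
  mu.-integrable `[a, +oo[ (EFin \o p) ->
  mu.-integrable `[a, +oo[ (EFin \o c).
Proof.
move=> cF dF fcp F0 cc c0 p0 ip.
have ic (x y : R) : mu.-integrable `[x, y] (EFin \o c).
  apply: continuous_compact_integrable; first exact: segment_compact.
  exact: continuous_subspaceT.
(* Starting at [a - 1] makes [a] an interior point, so that [C] has a two-sided derivative there
   too. *)
pose C t := \int[mu]_(r in `[a - 1, t]) c r.
have dC t : a <= t -> derivable C t 1 /\ C^`()%classic t = c t.
  move=> at_; apply: (@continuous_FTC1_closed _ c (a - 1) t (t + 1)) => //.
  - by rewrite ltrDl.
  - by rewrite ltrBlDr (le_lt_trans at_)// ltrDl.
  - exact: cc.
have idC t : a <= t -> is_derive t 1 C (c t).
  by move=> /dC[dCt <-]; rewrite derive1E; exact: derivableP.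
have cC t : a <= t -> {for t, continuous C}.
  by move=> /dC[dCt _]; apply: differentiable_continuous; apply/derivable1_diffP.
have FCg : dominated_growth (F \+ C) p a.
  apply: (@derive_le_dominated_growth _ (fun t => f t + c t)) => //.
  - by move=> t at_; apply: cvgD; [exact: cF|exact: cC].
  - by move=> t at_; apply: is_deriveD; [exact: dF|exact: idC (ltW at_)].
have [M M0 FCM] := dominated_growth_bounded p0 ip FCg.
have [l Cl] : exists l : R, C t @[t --> +oo] --> l.
  apply: (@nondecreasing_bounded_cvgy _ a M).
    move=> s t as_ st; apply: (@ger0_derive1_le_cc _ C s t) => //.
    - by move=> r; rewrite in_itv/= => /andP[sr _]; have [] := dC r (le_trans as_ (ltW sr)).
    - move=> r; rewrite in_itv/= => /andP[sr _].
      have ar := le_trans as_ (ltW sr).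
      by have [_ ->] := dC r ar; exact: c0.
    - apply: continuous_in_subspaceT => r; rewrite inE/= in_itv/= => /andP[sr _].
      by apply: cC; rewrite (le_trans as_).
    - by rewrite in_itv/= lexx.
    - by rewrite in_itv/= lexx st.
  by move=> t at_; have := FCM t at_; have := F0 t at_ => /=; lra.
apply/integrableP; split.
  apply: measurableT_comp => //.
  apply: (@measurable_funS _ _ _ _ setT) => //; exact: continuous_measurable_fun.
have -> : (\int[mu]_(t in `[a, +oo[) `|(EFin \o c) t| =
    \int[mu]_(t in `[a, +oo[) (c t)%:E)%E.
  apply: eq_integral => t; rewrite inE/= in_itv/= andbT => ta.
  by rewrite ger0_norm// c0.
apply: (@le_lt_trans _ _ (l%:E - (C a)%:E)%E); last by rewrite -EFinB ltry.
rewrite le_eqVlt; apply/orP; left; apply/eqP; apply: ge0_continuous_FTC2y => //.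
- exact: continuous_subspaceT.
- by move=> t /ltW /dC[].
- by apply: cvg_at_right_filter; exact: cC.
- by move=> t; rewrite in_itv/= andbT => /ltW /dC[].
Qed.
End growth.

(** * Scalar products and weak limits *)

Section hilbert.
Context (R : realType) (H : completeNormedModType R) (dot : {dot H for idfun}).
Implicit Types (u v w : H) (a : R).

Lemma dot_sym u v : dot u v = dot v u.
Proof. by rewrite hermC expr0 mul1r. Qed.

Lemma dotDl u v w : dot (u + v) w = dot u w + dot v w.
Proof. exact: linearDl. Qed.

Lemma dotDr u v w : dot u (v + w) = dot u v + dot u w.
Proof. exact: linearDr. Qed.

Lemma dotNl u v : dot (- u) v = - dot u v.
Proof. exact: linearNl. Qed.

Lemma dotNr u v : dot u (- v) = - dot u v.
Proof. exact: linearNr. Qed.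

Lemma dotZl a u v : dot (a *: u) v = a * dot u v.
Proof. exact: linearZl_LR. Qed.

Lemma dotZr a u v : dot u (a *: v) = a * dot u v.
Proof. by rewrite dot_sym dotZl dot_sym. Qed.

Definition dot_expand := (dotDl, dotDr, dotNl, dotNr, dotZl, dotZr).

Lemma dot_ge0 u : 0 <= dot u u.
Proof.
have [->|/neq0_dnorm_gt0/ltW//] := eqVneq u 0.
by rewrite linear0l.
Qed.

Hypothesis dot_norm : norm_of_dot dot.

Lemma sqr_norm_dot u : `|u| ^+ 2 = dot u u.
Proof. by rewrite dot_norm sqr_sqrtr// dot_ge0. Qed.

Lemma cauchy_schwarz u v : `|dot u v| <= `|u| * `|v|.
Proof.
have [->|v0] := eqVneq v 0.
  by rewrite normr0 mulr0 linear0r normr0.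
have vv : 0 < dot v v by exact: neq0_dnorm_gt0.
rewrite -(ler_pXn2r (n := 2))// ?nnegrE ?mulr_ge0// exprMn !sqr_norm_dot real_normK ?num_real//.
(* The squared norm of this vector is [dot v v] times the gap in the squared inequality. *)
have := dot_ge0 (dot v v *: u - dot u v *: v).
rewrite !dot_expand (dot_sym v u) => h.
have : 0 <= dot v v * (dot u u * dot v v - dot u v ^+ 2) by move: h; lra.
by rewrite pmulr_rge0// subr_ge0.
Qed.

Lemma dot_le u v : dot u v <= `|u| * `|v|.
Proof. exact: le_trans (ler_norm _) (cauchy_schwarz u v). Qed.

Lemma cvg_dot (T : Type) (F : set_system T) (FF : Filter F) (f g : T -> H) u v :
  f t @[t --> F] --> u -> g t @[t --> F] --> v ->
  dot (f t) (g t) @[t --> F] --> dot u v.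
Proof.
move=> fu gv.
have -> : (fun t => dot (f t) (g t)) = (fun t => dot (f t - u) (g t - v) +
    (dot (f t - u) v + dot u (g t - v)) + dot u v).
  by apply/funext => t; rewrite !dot_expand; ring.
rewrite -[dot u v in X in _ --> X]add0r; apply: cvgD; last exact: cvg_cst.
have fu0 : `|f t - u| @[t --> F] --> 0.
  by rewrite -(normr0 H); apply: cvg_norm; apply/subr_cvg0.
have gv0 : `|g t - v| @[t --> F] --> 0.
  by rewrite -(normr0 H); apply: cvg_norm; apply/subr_cvg0.
apply: norm_cvg0; apply: (@squeeze_cvgr _ _ _ _ (cst 0)
  (fun t => `|f t - u| * `|g t - v| + (`|f t - u| * `|v| + `|u| * `|g t - v|))).
- apply: nearW => t; rewrite normr_ge0/= (le_trans (ler_normD _ _))// lerD ?cauchy_schwarz//.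
  by rewrite (le_trans (ler_normD _ _))// lerD ?cauchy_schwarz.
- exact: cvg_cst.
rewrite -[X in _ --> X](_ : 0 * 0 + (0 * `|v| + `|u| * 0) = 0); last first.
  by rewrite !(mul0r,mulr0,addr0).
apply: cvgD; first exact: cvgM.
by apply: cvgD; apply: cvgM => //; exact: cvg_cst.
Qed.

Lemma is_derive_dot (x y : R -> H) (t : R) (dx dy : H) :
  is_derive t 1 x dx -> is_derive t 1 y dy ->
  is_derive t 1 (fun s => dot (x s) (y s)) (dot dx (y t) + dot (x t) dy).
Proof.
move=> [x1 x2] [y1 y2].
have cy : {for t, continuous y} by apply/differentiable_continuous/derivable1_diffP.
have ht : (h%:A + t : R) @[h --> (0 : R)^'] --> t.
  rewrite -[X in _ --> X](add0r t); apply: cvgD; last exact: cvg_cst.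
  under eq_fun do rewrite [_%:A]mulr1.
  exact: cvg_within.
have key : h^-1 *: (((fun s => dot (x s) (y s)) \o shift t) h%:A - dot (x t) (y t))
    @[h --> 0^'] --> dot dx (y t) + dot (x t) dy.
  have -> : (fun h => h^-1 *: (((fun s => dot (x s) (y s)) \o shift t) h%:A - dot (x t) (y t))) =
    (fun h => dot (h^-1 *: ((x \o shift t) h%:A - x t)) ((y \o shift t) h%:A) +
      dot (x t) (h^-1 *: ((y \o shift t) h%:A - y t))).
    by apply/funext => h; rewrite !dot_expand /GRing.scale/=; ring.
  apply: cvgD; apply: cvg_dot.
  - by rewrite -x2; exact: x1.
  - exact: (cvg_comp _ _ ht cy).
  - exact: cvg_cst.
  - by rewrite -y2; exact: y1.
by split; [apply/cvg_ex; exists (dot dx (y t) + dot (x t) dy)|exact: cvg_lim].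
Qed.

End hilbert.

(** * Limits along ultrafilters, weak cluster points and Opial's lemma *)

Lemma ultra_fmap (T S : Type) (f : T -> S) (U : set_system T) :
  UltraFilter U -> UltraFilter (f @ U).
Proof.
move=> UU; have PU : ProperFilter U by exact: ultra_proper.
split; first exact: fmap_proper_filter.
move=> G PG UG; apply/seteqP; split=> [A GA|//].
have [//|nA] := in_ultra_setVsetC (f @^-1` A) UU.
have /UG GnA : (f @ U) (~` A) by [].
have G0 : G set0 by rewrite -(setICr A); exact: filterI.
have : ~ G set0 by exact: filter_not_empty.
by [].
Qed.

Lemma ultra_bounded_cvg (R : realType) (T : Type) (U : set_system T)
    (f : T -> R) (M : R) : UltraFilter U ->
  (\forall t \near U, `|f t| <= M) -> exists l : R, f t @[t --> U] --> l.
Proof.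
move=> UU fM; have := @segment_compact R (- M) M; rewrite compact_ultra.
move=> /(_ _ (ultra_fmap f UU)); case.
  by rewrite /fmap/=; apply: filterS fM => t /=; rewrite in_itv/= ler_norml.
by move=> l [_ fl]; exists l.
Qed.

Section weak.
Context (R : realType) (H : completeNormedModType R) (dot : {dot H for idfun}).
Hypothesis dot_norm : norm_of_dot dot.
Let sqr_norm_dot := sqr_norm_dot dot_norm.
Let cvg_dot := cvg_dot dot_norm.

(* The weak limit is the minimizer of [z |-> |z|^2 - 2 lim dot (x t) z]. *)
Lemma ultra_bounded_weak_cvg (T : Type) (U : set_system T) (x : T -> H) (M : R) :
  UltraFilter U -> (\forall t \near U, `|x t| <= M) ->
  exists c : H, forall y, dot (x t) y @[t --> U] --> dot c y.
Proof.
move=> UU xM; have PU : ProperFilter U by exact: ultra_proper.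
have /choice[L xL] : forall y, exists l : R, dot (x t) y @[t --> U] --> l.
  move=> y; apply: (ultra_bounded_cvg (M := M * `|y|)).
  apply: filterS xM => t xM; rewrite (le_trans (cauchy_schwarz dot_norm _ _))//.
  by rewrite ler_wpM2r.
have LD y z : L (y + z) = L y + L z.
  have yz : dot (x t) (y + z) @[t --> U] --> L y + L z.
    by under eq_fun do rewrite dotDr; exact: cvgD.
  exact: (cvg_unique (@Rhausdorff R) (xL (y + z)) yz).
have LZ a y : L (a *: y) = a * L y.
  have ay : dot (x t) (a *: y) @[t --> U] --> a * L y.
    by under eq_fun do rewrite dotZr; apply: cvgM; [exact: cvg_cst|].
  exact: (cvg_unique (@Rhausdorff R) (xL (a *: y)) ay).
have LN y : L (- y) = - L y by rewrite -scaleN1r LZ mulN1r.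
have M0 : 0 <= M.
  by have [t] := filter_ex xM; exact: le_trans.
have LM y : `|L y| <= M * `|y|.
  apply: (cvgr_to_le (cvg_norm (xL y))).
  apply: filterS xM => t xM; rewrite (le_trans (cauchy_schwarz dot_norm _ _))//.
  by rewrite ler_wpM2r.
pose phi z := dot z z - 2 * L z.
have phi_lb : has_lbound (range phi).
  (* From [L z <= M |z|] one gets [phi z >= (|z| - M)^2 - M^2]. *)
  exists (- M ^+ 2) => _ [z _ <-]; rewrite /phi -sqr_norm_dot.
  have := LM z; rewrite ler_norml => /andP[_].
  have := sqr_ge0 (`|z| - M); lra.
have phi_inf : has_inf (range phi) by split => //; exists (phi 0), 0.
set m := inf (range phi).
have mphi z : m <= phi z by apply: ge_inf => //; exists z.
(* The parallelogram identity, with [m <= phi] used at the midpoint; it makes every minimizing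
   sequence Cauchy. *)
have phi_dist z w : `|z - w| ^+ 2 <= 2 * (phi z - m) + 2 * (phi w - m).
  have := mphi (2^-1 *: (z + w)); rewrite /phi sqr_norm_dot !dot_expand LZ LD.
  rewrite (dot_sym dot w z); lra.
have /choice[z zP] : forall n, exists z, phi z < m + n.+1%:R^-1.
  move=> n; have [|_ [z _ <-] zm] := @inf_adherent _ _ n.+1%:R^-1 _ phi_inf; first by [].
  by exists z.
have cz : cvg (z n @[n --> \oo]).
  apply/cauchy_cvgP; apply: cauchy_exP => e e0.
  have e4 : 0 < e ^+ 2 / 4 by rewrite divr_gt0// exprn_gt0.
  have [N _ NP] := near_infty_natSinv_lt (PosNum e4).
  exists (z N); exists N => // n /= Nn.
  rewrite -ball_normE/= -(ltr_pXn2r (n := 2))// ?nnegrE// ?ltW//.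
  rewrite (le_lt_trans (phi_dist _ _))//.
  have hN : N.+1%:R^-1 < e ^+ 2 / 4 := NP N (leqnn N).
  have hn : n.+1%:R^-1 < e ^+ 2 / 4 := NP n Nn.
  move: (zP N) (zP n) hN hn; move: N.+1%:R^-1 n.+1%:R^-1 => p q; lra.
set c := lim (z n @[n --> \oo]).
have Lz : L (z n) @[n --> \oo] --> L c.
  apply/subr_cvg0; apply: norm_cvg0; apply: (@squeeze_cvgr _ _ _ _ (cst 0)
    (fun n => M * `|z n - c|)).
  - by apply: nearW => n; rewrite normr_ge0/= -LN -LD LM.
  - exact: cvg_cst.
  rewrite -[X in _ --> X](mulr0 M); apply: cvgM; first exact: cvg_cst.
  by rewrite -(normr0 H); apply: cvg_norm; apply/subr_cvg0.
have phic : phi c <= m.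
  have h : phi (z n) @[n --> \oo] --> phi c.
    apply: cvgB; first exact: cvg_dot.
    by apply: cvgM; [exact: cvg_cst|].
  apply/ler_addgt0Pr => e e0; apply: (cvgr_to_le h).
  have := near_infty_natSinv_lt (PosNum e0); apply: filterS => n /= ne.
  by rewrite (le_trans (ltW (zP n)))// lerD2l ltW.
exists c => y; suff -> : dot c y = L y by exact: xL.
set d := dot c y; set q := dot y y.
have q0 : 0 <= q := dot_ge0 dot y.
(* Minimality of [c] along the line [c + s y]; the linear coefficient [d - L y] must therefore
   vanish. *)
have h (s : R) : 0 <= 2 * s * (d - L y) + s ^+ 2 * q.
  have := le_trans phic (mphi (c + s *: y)).
  rewrite /phi !dot_expand LD LZ (dot_sym dot y c) -/d -/q; lra.
(* Any small step against the sign of [d - L y] would do; dividing by [1 + q] instead of [q] also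
   covers [y = 0]. *)
have := h (- (d - L y) / (1 + q)).
have q1 : 0 < 1 + q by rewrite ltr_pwDl.
rewrite -(pmulr_rge0 _ (exprn_gt0 2 q1)).
have -> : (1 + q) ^+ 2 * (2 * (- (d - L y) / (1 + q)) * (d - L y) +
    (- (d - L y) / (1 + q)) ^+ 2 * q) = - ((d - L y) ^+ 2 * (2 + q)).
  by field; rewrite gt_eqF.
rewrite oppr_ge0 pmulr_lle0 ?ltr_pwDl// => d0.
by apply/eqP; rewrite -subr_eq0 -sqrf_eq0 eq_le d0 sqr_ge0.
Qed.

(** An ultrafilter refining [F] provides a weak limit [c] in [S]. If [x] failed to converge weakly
    to [c] along [F], some neighbourhood [B] would be avoided along a proper refinement [G] of [F];
    an ultrafilter refining [G] yields a second limit [c'], and convergence of the distances to [c]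
    and [c'] forces [c' = c], contradicting the choice of [G]. *)
Lemma opial (F : set_system R) (x : R -> H) (S : set H) (M : R) :
  ProperFilter F -> (\forall t \near F, `|x t| <= M) ->
  (forall z, S z -> exists l : R, `|x t - z| ^+ 2 @[t --> F] --> l) ->
  (forall (U : set_system R) c, UltraFilter U -> F `<=` U ->
    weakly_cvg dot x U c -> S c) ->
  exists2 c, S c & weakly_cvg dot x F c.
Proof.
move=> PF xM xS clS.
have ultra_lim (G : set_system R) : ProperFilter G -> F `<=` G ->
    exists U c, [/\ UltraFilter U, G `<=` U, S c & weakly_cvg dot x U c].
  move=> PG FG; have [U [UU GU]] := ultraFilterLemma PG.
  have FU : F `<=` U by apply: subset_trans FG GU.
  have [c xc] := ultra_bounded_weak_cvg UU (FU _ xM).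
  by exists U, c; split => //; exact: clS UU FU xc.
have [U [c [UU FU Sc xc]]] := ultra_lim F PF (@subset_refl _ F).
exists c => // y; apply: contrapT => nxy.
have [B [yB nB]] : exists B, nbhs (dot c y) B /\ ~ F ((fun t => dot (x t) y) @^-1` B).
  by apply: contrapT => nB; apply: nxy => B yB; apply: contrapT => nF; apply: nB; exists B.
pose G := within (~` ((fun t => dot (x t) y) @^-1` B)) F.
have PG : ProperFilter G.
  split; last exact: within_filter.
  by rewrite /G/within/=; apply: contra_not nB; apply: filterS => t h; apply: contrapT => /h.
have FG : F `<=` G by move=> A FA; rewrite /G/within/=; apply: filterS FA.
have [U' [c' [UU' GU' Sc' xc']]] := ultra_lim G PG FG.
have PU : ProperFilter U by exact: ultra_proper.
have PU' : ProperFilter U' by exact: ultra_proper.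
(* [|x t - c|^2 - |x t - c'|^2] converges along [F] and is affine in [x t], so
   the two weak limits [c] and [c'] give it the same limit. *)
have [l cl] := xS c Sc; have [l' cl'] := xS c' Sc'.
have aff : (fun t => `|x t - c| ^+ 2 - `|x t - c'| ^+ 2) =
    (fun t => 2 * dot (x t) (c' - c) + (dot c c - dot c' c')).
  apply/funext => t; rewrite !sqr_norm_dot !dot_expand.
  by rewrite (dot_sym dot c) (dot_sym dot c'); ring.
have affF : 2 * dot (x t) (c' - c) + (dot c c - dot c' c') @[t --> F] --> l - l'.
  by rewrite -aff; exact: cvgB.
have affU (V : set_system R) b : ProperFilter V -> F `<=` V -> weakly_cvg dot x V b ->
    2 * dot b (c' - c) + (dot c c - dot c' c') = l - l'.
  move=> PV FV xb.
  have hl : 2 * dot (x t) (c' - c) + (dot c c - dot c' c') @[t --> V] --> l - l'.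
    by move=> A /affF; exact: FV.
  have hb : 2 * dot (x t) (c' - c) + (dot c c - dot c' c') @[t --> V] -->
      2 * dot b (c' - c) + (dot c c - dot c' c').
    apply: cvgD; last exact: cvg_cst.
    by apply: cvgM; [exact: cvg_cst|exact: xb].
  exact: (cvg_unique (@Rhausdorff R) hb hl).
have cc' : c' = c.
  (* Subtracting the affine identities at [c] and [c'] leaves [2 |c' - c|^2 = 0]. *)
  apply/eqP; rewrite -subr_eq0 -normr_eq0 -sqrf_eq0 sqr_norm_dot.
  have := affU U c PU FU xc; have := affU U' c' PU' (subset_trans FG GU') xc'.
  rewrite dotDl dotNl; lra.
rewrite cc' in xc'.
have U'B := xc' y _ yB.
have U'nB : U' (~` ((fun t => dot (x t) y) @^-1` B)).
  by apply: GU'; exact: withinT.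
have U'0 : U' set0.
  rewrite -(setICr ((fun t => dot (x t) y) @^-1` B)); exact: (@filterI _ U' _ _ _ U'B U'nB).
have : ~ U' set0 by exact: filter_not_empty.
by [].
Qed.
End weak.

(** * Gradients, and curves on a half-line *)

Section gradient.
Context (R : realType) (H : completeNormedModType R) (dot : {dot H for idfun}).
Context (Phi : H -> R) (gradPhi : H -> H).
Hypothesis Phi_grad : is_gradient dot Phi gradPhi.

Lemma gradient_continuous : continuous Phi.
Proof.
by move=> u; apply: (@differentiable_continuous _ _ R^o); have [] := Phi_grad u.
Qed.

Lemma gradient_is_derive u v : is_derive u v (Phi : H -> R^o) (dot (gradPhi u) v).
Proof.
have [dPhi Phi_E] := Phi_grad u.
by split; [exact: diff_derivable|rewrite deriveE// Phi_E].
Qed.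

(** Convexity on the segment from [u] to [v] bounds the difference quotients at [u] by
    [Phi v - Phi u]; the limit from the right gives the claim. *)
Lemma convex_gradient_le u v :
  convex_function setT (Phi : convex_lmodType H -> R^o) ->
  Phi u + dot (gradPhi u) (v - u) <= Phi v.
Proof.
move=> Phi_convex; rewrite -lerBrDl.
have [d1 d2] := gradient_is_derive u (v - u).
have : h^-1 *: ((Phi \o shift u) (h *: (v - u)) - Phi u : R^o) @[h --> 0^'+]
    --> dot (gradPhi u) (v - u).
  by rewrite -d2; exact: (cvg_dnbhs_at_right d1).
move=> /cvgr_to_le; apply; near=> h.
have h0 : 0 < h by near: h; exact: nbhs_right_gt.
have h1 : h <= 1 by near: h; exact: nbhs_right_le.
rewrite /GRing.scale/= ler_pdivrMl//.
have := Phi_convex (Itv01 (ltW h0) h1) v u (in_setT _) (in_setT _).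
rewrite !convRE/= /conv/=.
rewrite /unstable.onem (_ : h *: v + (1 - h) *: u = h *: (v - u) + u); first by
  rewrite -[GRing.Nmodule_isLSemiModule.scale _ _ _]/(h *: (v - u)); lra.
by rewrite scalerBr scalerBl scale1r addrCA addrC.
Unshelve. all: by end_near. Qed.

Lemma is_derive_gradient_comp (x : R -> H) (t : R) dx : is_derive t 1 x dx ->
  is_derive t 1 (fun s => Phi (x s)) (dot (gradPhi (x t)) dx).
Proof.
move=> [x1 x2]; have dx_t : differentiable x t by apply/derivable1_diffP.
have [dPhi Phi_E] := Phi_grad (x t).
have dc : differentiable ((Phi : H -> R^o) \o x) t by exact: differentiable_comp.
split; first exact: diff_derivable.
rewrite (_ : (fun s => _) = (Phi : H -> R^o) \o x)// deriveE// diff_comp//=.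
by rewrite Phi_E -x2 deriveE.
Qed.
End gradient.

(** * Curves on a half-line and their extension to the whole line *)

Section halfline.
Context (R : realType) (H : normedModType R) (a : R) (x : R -> H).
Notation I := `[a, +oo[%classic.
(** The curve is frozen at [x a] to the left of [a], so that ordinary continuity and derivatives can
    replace the one-sided notions. *)
Let x_ext (t : R) := x (Num.max a t).

Lemma derivable_within_quotient t : derivable_within I x t ->
  forall e, 0 < e -> exists2 d, 0 < d & forall s, a <= s -> s != t -> `|t - s| < d ->
    `|derive_within I x t - (s - t)^-1 *: (x s - x t)| < e.
Proof.
move=> xt e e0; have /cvgrPdist_lt/(_ e e0) := xt.
rewrite near_withinE => /nbhs_ballP[/= d d0 dP]; exists d => // s as_ st tsd.
by apply: dP => //=; rewrite in_itv/= andbT.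
Qed.

Lemma extension_is_derive t : a < t -> derivable_within I x t ->
  is_derive t 1 x_ext (derive_within I x t).
Proof.
move=> at_ /derivable_within_quotient xt.
have key : h^-1 *: ((x_ext \o shift t) h%:A - x_ext t) @[h --> 0^'] --> derive_within I x t.
  apply/cvgrPdist_lt => e e0; have [d d0 dP] := xt e e0.
  rewrite nearE; apply/nbhs_ballP; exists (Num.min d (t - a)).
    by rewrite /= lt_min d0 subr_gt0.
  move=> h; rewrite /ball/= sub0r normrN lt_min => /andP[hd hta] h0.
  have hN : - h <= `|h| by rewrite -normrN ler_norm.
  rewrite /x_ext [h%:A]mulr1.
  rewrite (_ : Num.max a (h + t) = h + t); last by apply/max_idPr; lra.
  rewrite (_ : Num.max a t = t); last by apply/max_idPr; exact: ltW.
  have := dP (h + t); rewrite addrK; apply; first lra.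
  - by rewrite -subr_eq0 addrK.
  - by rewrite opprD addrCA subrr addr0 normrN.
by split; [apply/cvg_ex; exists (derive_within I x t)|exact: cvg_lim].
Qed.

(** Near [m] the difference quotients have norm below [K], the norm of the derivative plus one, so
    increments from [m] are at most [K] times the displacement; and [Num.max a] does not increase
    distances. *)
Lemma extension_continuous : (forall t, a <= t -> derivable_within I x t) ->
  continuous x_ext.
Proof.
move=> xd t; set m := Num.max a t.
have am : a <= m by rewrite le_max lexx.
have [d d0 dP] := derivable_within_quotient (xd m am) ltr01.
set K := `|derive_within I x m| + 1.
have K0 : 0 < K by rewrite ltr_wpDl.
apply/cvgrPdist_lt => e e0; near=> s.
have tsd : `|t - s| < Num.min d (e / K).
  near: s; apply/nbhs_ballP; exists (Num.min d (e / K)) => //=.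
  by rewrite lt_min d0 divr_gt0.
rewrite /x_ext -/m; set s' := Num.max a s.
have ms : `|m - s'| <= `|t - s|.
  rewrite /m /s'; case: (leP a t) => ?; case: (leP a s) => ? //=.
  - rewrite !ger0_norm; lra.
  - rewrite !ler0_norm; lra.
  - by rewrite subrr normr0.
have [->|sm] := eqVneq s' m; first by rewrite subrr normr0.
move: tsd; rewrite lt_min => /andP[tsd tse].
have as_ : a <= s' by rewrite le_max lexx.
have := dP s' as_ sm (le_lt_trans ms tsd).
have sm0 : 0 < `|s' - m| by rewrite normr_gt0 subr_eq0.
set q := _^-1 *: _ => hq.
have qK : `|q| < K.
  rewrite (_ : q = derive_within I x m - (derive_within I x m - q)).
    by rewrite (le_lt_trans (ler_normB _ _))// ltrD2l.
  by rewrite subKr.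
have -> : x m - x s' = - ((s' - m) *: q).
  by rewrite /q scalerA divff ?subr_eq0// scale1r opprB.
rewrite normrN normrZ distrC (le_lt_trans (ler_pM _ _ ms (ltW qK)))//.
by rewrite -ltr_pdivlMr.
Unshelve. all: by end_near. Qed.
End halfline.

(** * A logarithmic Gronwall lemma *)

Section gronwall.
Context (R : realType).
Implicit Types (F f p : R -> R) (a : R).
Notation mu := (@lebesgue_measure R).

Lemma integrable_scaler (D : set (measurableTypeR R)) f (k : R) : measurable D ->
  mu.-integrable D (EFin \o f) -> mu.-integrable D (EFin \o (fun t => k * f t)).
Proof. by move=> mD intf; exact: (integrableZl mD k intf). Qed.

Lemma integrable_scaler_inv (D : set (measurableTypeR R)) f (k : R) :
  measurable D -> k != 0 ->
  mu.-integrable D (EFin \o (fun t => k * f t)) -> mu.-integrable D (EFin \o f).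
Proof.
move=> mD k0 /(integrable_scaler k^-1 mD); apply: (eq_integrable mD) => t _ /=.
by rewrite mulKf.
Qed.

Lemma integrable_addr (D : set (measurableTypeR R)) f1 f2 : measurable D ->
  mu.-integrable D (EFin \o f1) -> mu.-integrable D (EFin \o f2) ->
  mu.-integrable D (EFin \o (fun t => f1 t + f2 t)).
Proof. by move=> mD int1 int2; exact: (integrableD mD int1 int2). Qed.

(* [ln (1 + F)] has derivative at most [p]. *)
Lemma log_gronwall F f p a :
  (forall t, a <= t -> {for t, continuous F}) ->
  (forall t, a < t -> is_derive t 1 F (f t)) ->
  (forall t, a < t -> f t <= p t * (1 + F t)) ->
  (forall t, a <= t -> 0 <= F t) -> (forall t, a <= t -> 0 <= p t) ->
  mu.-integrable `[a, +oo[ (EFin \o p) ->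
  exists2 M, 0 <= M & forall t, a <= t -> F t <= M.
Proof.
move=> cF dF fp F0 p0 ip.
have F1 t : a <= t -> 0 < 1 + F t by move=> /F0 Ft; rewrite ltr_pwDl.
have lnFg : dominated_growth (fun t => ln (1 + F t)) p a.
  apply: (@derive_le_dominated_growth _ _ (fun t => (1 + F t)^-1 * f t)) => //.
  - move=> t at_; apply: (continuous_comp (f := fun t => 1 + F t)).
      by apply: cvgD; [exact: cvg_cst|exact: cF].
    exact: continuous_ln (F1 t at_).
  - move=> t at_; have d1 : is_derive t 1 (fun t => 1 + F t) (f t).
      have := is_deriveD (is_derive_cst (1 : R) t 1) (dF t at_).
      by rewrite add0r.
    have dln := is_derive1_ln (F1 t (ltW at_)).
    exact: (@is_derive1_comp _ (@ln R) (fun s => 1 + F s) t _ _ dln d1).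
  - by move=> t at_; rewrite ler_pdivrMl; [rewrite mulrC; exact: fp|exact: F1 (ltW at_)].
have [M M0 lnM] := dominated_growth_bounded p0 ip lnFg.
exists (expR M); first exact: expR_ge0.
move=> t at_; have := lnM t at_; rewrite -ler_expR lnK ?posrE ?F1//.
by apply: le_trans; rewrite lerDr.
Qed.
End gronwall.

(** Young's inequality; it bounds the factors of [g] in the energy derivatives by one plus an
    energy, the shape that [log_gronwall] accepts. *)
Lemma norm_le_half_sqr (R : realType) (H : completeNormedModType R) (dot : {dot H for idfun})
    (dot_norm : norm_of_dot dot) (u : H) : `|u| <= 2^-1 + 2^-1 * dot u u.
Proof. by have := sqr_ge0 (`|u| - 1); have := sqr_norm_dot dot_norm u; nra. Qed.

(** * The energies along a trajectory *)

Section dynamics.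
Context (R : realType) (H : completeNormedModType R) (dot : {dot H for idfun}).
Hypothesis dot_norm : norm_of_dot dot.
Context (Phi : H -> R) (gradPhi : H -> H).
Hypothesis Phi_convex : convex_function setT (Phi : convex_lmodType H -> R^o).
Hypothesis Phi_grad : is_gradient dot Phi gradPhi.
Context (t0 alpha : R).
Hypotheses (t0_gt0 : 0 < t0) (alpha_gt3 : 3 < alpha).
Context (g : R -> H).
Notation mu := (@lebesgue_measure R).
Notation halfline := `[t0, +oo[%classic.
Hypothesis g_int : mu.-integrable halfline (EFin \o (fun t => t * `|g t|)).
Context (X V : R -> H).
Hypotheses (X_cont : continuous X) (V_cont : continuous V).
Hypothesis dX : forall t, t0 < t -> is_derive t 1 X (V t).
Hypothesis dV : forall t, t0 < t ->
  is_derive t 1 V (g t - (alpha / t) *: V t - gradPhi (X t)).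
Context (z : H).
Hypothesis z_min : argmin Phi z.

Let phi t := Phi (X t) - Phi z.
Let w t := dot (V t) (V t).
Let r t := dot (X t - z) (V t).
Let q t := dot (X t - z) (X t - z).

(* [Y] and [E] of the header, expanded in scalar functions so that their
   derivatives reduce to those of [phi], [w], [r] and [q]. *)
Let kinetic t := t ^+ 2 * (phi t + 2^-1 * w t).
Let energy t := kinetic t + (alpha - 1) * (t * r t) + (alpha - 1) ^+ 2 / 2 * q t.

Let t_gt0 t : t0 <= t -> 0 < t. Proof. exact: lt_le_trans. Qed.
Let phi_ge0 t : 0 <= phi t. Proof. by rewrite subr_ge0. Qed.
Let w_ge0 t : 0 <= w t. Proof. exact: dot_ge0. Qed.
Let q_ge0 t : 0 <= q t. Proof. exact: dot_ge0. Qed.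

Let phi_cont : continuous phi.
Proof.
move=> t; apply: cvgB; last exact: cvg_cst.
have h1 : X s @[s --> t] --> X t by exact: X_cont.
have h2 : Phi u @[u --> X t] --> Phi (X t) by exact: (gradient_continuous Phi_grad).
have h3 : Phi (X s) @[s --> t] --> Phi (X t) := cvg_comp _ _ h1 h2.
exact: h3.
Qed.

Let h_cont t : X s - z @[s --> t] --> X t - z.
Proof. by apply: cvgB; [exact: X_cont|exact: cvg_cst]. Qed.

Let w_cont : continuous w.
Proof. by move=> t; apply: cvg_dot => //; exact: V_cont. Qed.

Let r_cont : continuous r.
Proof. by move=> t; apply: cvg_dot => //; [exact: h_cont|exact: V_cont]. Qed.

Let q_cont : continuous q.
Proof. by move=> t; apply: cvg_dot => //; exact: h_cont. Qed.

Let kinetic_cont : continuous kinetic.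
Proof.
move=> t; apply: cvgM; first exact: exprn_continuous.
apply: cvgD; first exact: phi_cont.
by apply: cvgM; [exact: cvg_cst|exact: w_cont].
Qed.

Let energy_cont : continuous energy.
Proof.
move=> t; apply: cvgD; first (apply: cvgD; first exact: kinetic_cont).
  apply: cvgM; first exact: cvg_cst.
  by apply: cvgM; [exact: cvg_id|exact: r_cont].
by apply: cvgM; [exact: cvg_cst|exact: q_cont].
Qed.

(** The two gradient terms cancel, and [t w] from differentiating [t^2] offsets one unit of the
    friction [alpha t w]. *)
Let kinetic_derive t : t0 < t -> is_derive t 1 kinetic
  (2 * (t * phi t) - (alpha - 1) * (t * w t) + t ^+ 2 * dot (V t) (g t)).
Proof.
move=> tt0; have t_neq0 : t != 0 by rewrite gt_eqF// (lt_trans t0_gt0).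
have dphi : is_derive t 1 phi (dot (gradPhi (X t)) (V t)).
  have := is_deriveB (is_derive_gradient_comp Phi_grad (dX tt0)) (is_derive_cst (Phi z) t 1).
  by rewrite subr0.
have dw := is_derive_dot dot_norm (dV tt0) (dV tt0).
have dt2 : is_derive t 1 ((@id R) ^+ 2) _ := is_deriveX 2 (is_derive_id t 1).
apply: is_derive_eq (is_deriveM dt2 (is_deriveD dphi (is_deriveZ 2^-1 dw))) _.
rewrite !dot_expand (dot_sym dot (gradPhi _)) (dot_sym dot (g t)) /w /GRing.scale/=.
rewrite -[(id ^+ 2) t]/(t * t) -[(phi + _) t]/(phi t + 2^-1 * dot (V t) (V t)).
by field.
Qed.

(** The weights in [energy] are chosen so that all terms in [w] and in [r] cancel, leaving the
    potential, the forcing and the gradient paired with [X t - z]. *)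
Let energy_derive t : t0 < t -> is_derive t 1 energy
  (2 * (t * phi t) + t * dot ((alpha - 1) *: (X t - z) + t *: V t) (g t)
   - (alpha - 1) * (t * dot (X t - z) (gradPhi (X t)))).
Proof.
move=> tt0; have t_neq0 : t != 0 by rewrite gt_eqF// (lt_trans t0_gt0).
have dh : is_derive t 1 (fun s => X s - z) (V t).
  by have := is_deriveB (dX tt0) (is_derive_cst z t 1); rewrite subr0.
have dr := is_derive_dot dot_norm dh (dV tt0).
have dq := is_derive_dot dot_norm dh dh.
apply: is_derive_eq (is_deriveD (is_deriveD (kinetic_derive tt0)
  (is_deriveZ (alpha - 1) (is_deriveM (is_derive_id t 1) dr)))
  (is_deriveZ ((alpha - 1) ^+ 2 / 2) dq)) _.
rewrite !dot_expand (dot_sym dot (V t) (X t)) (dot_sym dot (V t) z) /w /GRing.scale/=.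
by rewrite mulr1; field.
Qed.

Let energyE t : energy t =
  t ^+ 2 * phi t + 2^-1 * `|(alpha - 1) *: (X t - z) + t *: V t| ^+ 2.
Proof.
rewrite (sqr_norm_dot dot_norm) /energy /kinetic /q /r /w; move: (X t - z) => h.
by rewrite !dot_expand (dot_sym dot (V t) h); field.
Qed.

Let energy_ge0 t : 0 <= energy t.
Proof. by rewrite energyE addr_ge0// mulr_ge0// ?sqr_ge0// invr_ge0. Qed.

Let kinetic_ge0 t : 0 <= kinetic t.
Proof. by rewrite mulr_ge0 ?sqr_ge0// addr_ge0// mulr_ge0// invr_ge0. Qed.

Let grad_ge t : phi t <= dot (X t - z) (gradPhi (X t)).
Proof.
have := convex_gradient_le Phi_grad (X t) z Phi_convex.
by rewrite -opprB dotNr (dot_sym dot) /phi; lra.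
Qed.

Let g_ge0 t : t0 <= t -> 0 <= t * `|g t|.
Proof. by move=> /t_gt0/ltW ?; rewrite mulr_ge0. Qed.

(** Convexity bounds the gradient term by [- (alpha - 1) t phi], and
    [2 - (alpha - 1) = - (alpha - 3)]. The resulting dissipation is kept on the left because its
    integrability is wanted later. *)
Let energy_derive_le t : t0 < t ->
  2 * (t * phi t) + t * dot ((alpha - 1) *: (X t - z) + t *: V t) (g t)
   - (alpha - 1) * (t * dot (X t - z) (gradPhi (X t))) + (alpha - 3) * (t * phi t)
  <= t * `|g t| * `|(alpha - 1) *: (X t - z) + t *: V t|.
Proof.
move=> tt0; have t_gt : 0 < t by apply: lt_trans tt0.
set v := (alpha - 1) *: _ + _.
have h1 : t * dot v (g t) <= t * `|g t| * `|v|.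
  by rewrite -mulrA ler_pM2l// mulrC dot_le.
have h2 : (alpha - 1) * (t * phi t) <= (alpha - 1) * (t * dot (X t - z) (gradPhi (X t))).
  by apply: ler_wpM2l; [have := alpha_gt3; lra|rewrite ler_pM2l].
lra.
Qed.

Let momentum_le t : `|(alpha - 1) *: (X t - z) + t *: V t| <= 1 + energy t.
Proof.
have := norm_le_half_sqr dot_norm ((alpha - 1) *: (X t - z) + t *: V t).
rewrite energyE (sqr_norm_dot dot_norm).
have : 0 <= t ^+ 2 * phi t by rewrite mulr_ge0// sqr_ge0.
lra.
Qed.

(** * Boundedness, integrability and asymptotics of the energies *)

Lemma energy_bounded : exists2 M, 0 <= M & forall t, t0 <= t -> energy t <= M.
Proof.
apply: (@log_gronwall _ _ _ (fun t => t * `|g t|) t0 _ energy_derive) => //.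
- by move=> t _; exact: energy_cont.
- move=> t tt0.
  have t_gt : 0 < t by apply: lt_trans tt0.
  have := energy_derive_le tt0.
  have : t * `|g t| * `|(alpha - 1) *: (X t - z) + t *: V t| <= t * `|g t| * (1 + energy t).
    by rewrite ler_wpM2l// g_ge0// ltW.
  have : 0 <= (alpha - 3) * (t * phi t).
    by rewrite mulr_ge0 ?subr_ge0 ?(ltW alpha_gt3)// mulr_ge0// ltW.
  by lra.
Qed.

Lemma value_gap_bounded :
  exists2 C, 0 <= C & forall t, t0 <= t -> t ^+ 2 * (Phi (X t) - Phi z) <= C.
Proof.
have [M M0 EM] := energy_bounded; exists M => // t tt0.
apply: le_trans (EM t tt0); rewrite energyE lerDl.
by rewrite mulr_ge0// ?sqr_ge0// invr_ge0.
Qed.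

(** Once [energy] is bounded by [M], the forcing is at most [(1 + M) t |g t|], so the dissipation
    [(alpha - 3) t phi] is integrable, and [alpha > 3] allows division by its factor. *)
Lemma value_gap_integrable :
  mu.-integrable halfline (EFin \o (fun t => t * (Phi (X t) - Phi z))).
Proof.
have [M M0 EM] := energy_bounded.
have M1 : 0 <= 1 + M by rewrite addr_ge0.
have a3 : 0 < alpha - 3 by rewrite subr_gt0.
apply: (@integrable_scaler_inv _ _ _ (alpha - 3)); [exact: measurable_itv|by rewrite gt_eqF|].
apply: (@derive_add_le_integrable _ energy _ _
  (fun t => (1 + M) * (t * `|g t|)) t0 _ energy_derive).
- by move=> t _; exact: energy_cont.
- move=> t tt0; apply: le_trans (energy_derive_le tt0) _.
  rewrite mulrC; apply: ler_wpM2r; first exact: g_ge0 (ltW tt0).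
  by rewrite (le_trans (momentum_le t))// lerD2l EM// ltW.
- by move=> t _; exact: energy_ge0.
- move=> t; apply: cvgM; first exact: cvg_cst.
  by apply: cvgM; [exact: cvg_id|exact: phi_cont].
- by move=> t /t_gt0 tt0; rewrite mulr_ge0 ?(ltW a3)// mulr_ge0 ?(ltW tt0)// subr_ge0.
- by move=> t tt0; rewrite mulr_ge0// g_ge0.
- by apply: integrable_scaler; [exact: measurable_itv|exact: g_int].
Qed.

Let speed_le t : t0 <= t -> t * `|V t| <= 1 + kinetic t.
Proof.
move=> /t_gt0 tt0; have := norm_le_half_sqr dot_norm (t *: V t).
rewrite normrZ gtr0_norm// !dot_expand -/(w t) /kinetic.
have : 0 <= t ^+ 2 * phi t by rewrite mulr_ge0// sqr_ge0.
by lra.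
Qed.

Let power_le t : t0 <= t -> t ^+ 2 * dot (V t) (g t) <= t * `|g t| * (t * `|V t|).
Proof.
move=> /t_gt0 tt0; rewrite expr2 -!mulrA ler_pM2l// mulrCA ler_pM2l//.
by rewrite mulrC dot_le.
Qed.

(** The derivative of [kinetic] contains [2 t phi] with the unfavourable sign; it can enter the
    Gronwall rate because [value_gap_integrable] has made it integrable. *)
Lemma kinetic_bounded : exists2 M, 0 <= M & forall t, t0 <= t -> kinetic t <= M.
Proof.
apply: (@log_gronwall _ _ _ (fun t => 2 * (t * phi t) + t * `|g t|) t0 _ kinetic_derive).
- by move=> t _; exact: kinetic_cont.
- move=> t tt0; have t_gt : 0 < t by apply: lt_trans tt0.
  have tphi : 0 <= t * phi t by rewrite mulr_ge0// ltW.
  have aw : 0 <= (alpha - 1) * (t * w t).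
    by rewrite mulr_ge0 ?mulr_ge0 ?(ltW t_gt)// subr_ge0; have := alpha_gt3; lra.
  have gV := power_le (ltW tt0).
  have gV' : t * `|g t| * (t * `|V t|) <= t * `|g t| * (1 + kinetic t).
    by rewrite ler_wpM2l ?g_ge0 ?speed_le// ltW.
  have : 0 <= (t * phi t) * kinetic t by rewrite mulr_ge0.
  by move: gV gV' aw tphi; rewrite !mulrDl !mulrDr !mulr1; lra.
- by move=> t _; exact: kinetic_ge0.
- move=> t tt0; rewrite addr_ge0 ?g_ge0// mulr_ge0// mulr_ge0//.
  by rewrite ltW// t_gt0.
- apply: integrable_addr; [exact: measurable_itv| |exact: g_int].
  by apply: integrable_scaler; [exact: measurable_itv|exact: value_gap_integrable].
Qed.

Lemma speed_bounded : exists2 C, 0 <= C & forall t, t0 <= t -> t * `|V t| <= C.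
Proof.
have [M M0 kM] := kinetic_bounded; exists (1 + M); first by rewrite addr_ge0.
by move=> t tt0; rewrite (le_trans (speed_le tt0))// lerD2l kM.
Qed.

Lemma speed_integrable :
  mu.-integrable halfline (EFin \o (fun t => t * `|V t| ^+ 2)).
Proof.
have [C C0 VC] := speed_bounded.
have a1 : 0 < alpha - 1 by have := alpha_gt3; lra.
have -> : (fun t => t * `|V t| ^+ 2) = (fun t => t * w t).
  by apply/funext => t; rewrite (sqr_norm_dot dot_norm).
apply: (@integrable_scaler_inv _ _ _ (alpha - 1)); [exact: measurable_itv|by rewrite gt_eqF|].
apply: (@derive_add_le_integrable _ kinetic _ _
  (fun t => 2 * (t * phi t) + C * (t * `|g t|)) t0 _ kinetic_derive).
- by move=> t _; exact: kinetic_cont.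
- move=> t tt0; rewrite addrAC subrK lerD2l.
  apply: le_trans (power_le (ltW tt0)) _.
  by rewrite mulrC ler_wpM2r ?g_ge0 ?VC// ltW.
- by move=> t _; exact: kinetic_ge0.
- move=> t; apply: cvgM; first exact: cvg_cst.
  by apply: cvgM; [exact: cvg_id|exact: w_cont].
- by move=> t /t_gt0/ltW tt0; rewrite mulr_ge0 ?(ltW a1)// mulr_ge0.
- move=> t tt0; rewrite addr_ge0//; last by rewrite mulr_ge0 ?g_ge0.
  by rewrite mulr_ge0// mulr_ge0// ltW// t_gt0.
- apply: integrable_addr; first exact: measurable_itv.
    by apply: integrable_scaler; [exact: measurable_itv|exact: value_gap_integrable].
  by apply: integrable_scaler; [exact: measurable_itv|exact: g_int].
Qed.
(* [kinetic] has a limit at infinity, and [kinetic t / t] is integrable. *)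
Lemma kinetic_cvg0 : kinetic t @[t --> +oo] --> 0.
Proof.
have [C C0 VC] := speed_bounded.
have int_kin : mu.-integrable halfline (EFin \o (fun t => t^-1 * kinetic t)).
  have := integrable_addr (measurable_itv _) value_gap_integrable
    (integrable_scaler 2^-1 (measurable_itv _) speed_integrable).
  apply: eq_integrable; first exact: measurable_itv.
  move=> t; rewrite inE/= in_itv/= andbT => /t_gt0 tt0.
  congr (_%:E); rewrite (sqr_norm_dot dot_norm) -/(w t) -/(phi t) /kinetic.
  by field; rewrite gt_eqF.
have [l kl] : exists l : R, kinetic t @[t --> +oo] --> l.
  apply: (@dominated_growth_cvg _ kinetic (fun t => 2 * (t * phi t) + C * (t * `|g t|)) t0 0).
  - move=> t tt0; rewrite addr_ge0//; last by rewrite mulr_ge0 ?g_ge0.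
    by rewrite mulr_ge0// mulr_ge0// ltW// t_gt0.
  - apply: integrable_addr; first exact: measurable_itv.
      by apply: integrable_scaler; [exact: measurable_itv|exact: value_gap_integrable].
    by apply: integrable_scaler; [exact: measurable_itv|exact: g_int].
  - apply: (derive_le_dominated_growth _ kinetic_derive).
    + by move=> t _; exact: kinetic_cont.
    + move=> t tt0; have t_gt : 0 < t by apply: lt_trans tt0.
      have : t ^+ 2 * dot (V t) (g t) <= C * (t * `|g t|).
        apply: le_trans (power_le (ltW tt0)) _.
        by rewrite mulrC ler_wpM2r ?g_ge0 ?VC// ltW.
      have : 0 <= (alpha - 1) * (t * w t).
        by rewrite mulr_ge0 ?mulr_ge0 ?(ltW t_gt)// subr_ge0; have := alpha_gt3; lra.
      by lra.
    + move=> t tt0; rewrite addr_ge0//; last by rewrite mulr_ge0 ?g_ge0.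
      by rewrite mulr_ge0// mulr_ge0// ltW// t_gt0.
    + apply: integrable_addr; first exact: measurable_itv.
        by apply: integrable_scaler; [exact: measurable_itv|exact: value_gap_integrable].
      by apply: integrable_scaler; [exact: measurable_itv|exact: g_int].
  - by move=> t _; exact: kinetic_ge0.
have l0 : 0 <= l by apply: (cvgr_to_ge kl); apply: nearW => t; exact: kinetic_ge0.
have [lE|ln0] := eqVneq l 0; first by rewrite -lE.
exfalso.
have lgt0 : 0 < l by rewrite lt0r ln0.
have [b [tb bl]] : exists b, t0 <= b /\ forall t, b <= t -> l / 2 <= kinetic t.
  have : \forall t \near +oo, l / 2 < kinetic t.
    by apply: (cvgr_gt _ kl); rewrite ltr_pdivrMr// ltr_pMr// ltr1n.
  move=> [b [_ bP]]; exists (Num.max t0 (b + 1)); split; first by rewrite le_max lexx.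
  move=> t; rewrite ge_max => /andP[_ bt]; apply/ltW/bP.
  by rewrite (lt_le_trans _ bt)// ltrDl.
(* If [l > 0], then beyond [b] the function [1 / t] is at most [2 / l * (kinetic t / t)], which is
   integrable; [ln] would then be bounded. *)
have int_b : mu.-integrable `[b, +oo[ (EFin \o (fun t => 2 / l * (t^-1 * kinetic t))).
  apply: integrable_scaler; first exact: measurable_itv.
  apply: (integrableS _ _ _ int_kin); [exact: measurable_itv|exact: measurable_itv|].
  by apply: subset_itvr; rewrite bnd_simp.
have b_gt0 t : b <= t -> 0 < t by move=> bt; apply: (lt_le_trans t0_gt0); exact: le_trans bt.
have p0 t : b <= t -> 0 <= 2 / l * (t^-1 * kinetic t).
  move=> /b_gt0 t_gt; rewrite mulr_ge0 ?divr_ge0// mulr_ge0 ?invr_ge0//.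
  exact: ltW.
have lng : dominated_growth (@ln R) (fun t => 2 / l * (t^-1 * kinetic t)) b.
  apply: (@derive_le_dominated_growth _ _ (fun t => t^-1)) => //.
  - by move=> t bt; apply: continuous_ln; exact: b_gt0.
  - by move=> t bt; apply: is_derive1_ln; exact: b_gt0 (ltW bt).
  - move=> t /ltW bt; have := bl t bt => kt.
    have ti : 0 < t^-1 by rewrite invr_gt0 b_gt0.
    rewrite mulrCA -[leLHS]mulr1 ler_pM2l// mulrAC ler_pdivlMr// mul1r.
    by move: kt; rewrite ler_pdivrMr// mulrC.
have [M M0 lnM] := dominated_growth_bounded p0 int_b lng.
(* At this point, which lies beyond [b], [ln] is at least [M + 1]. *)
have := lnM (Num.max b (expR (M + 1))); rewrite le_max lexx => /(_ isT).
apply/negP; rewrite -ltNge (@lt_le_trans _ _ (M + 1))// ?ltrDl//.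
by rewrite -{1}(expRK (M + 1)) ler_ln ?posrE ?expR_gt0 ?le_max ?lexx ?orbT// lt_max expR_gt0 orbT.
Qed.

(** Up to the factor [alpha - 1], [X t - z] is the momentum, bounded through [energy], minus
    [t V t], bounded by [speed_bounded]. *)
Lemma trajectory_bounded : exists2 C, 0 <= C & forall t, t0 <= t -> `|X t - z| <= C.
Proof.
have [M M0 EM] := energy_bounded; have [C C0 VC] := speed_bounded.
have a1 : 0 < alpha - 1 by have := alpha_gt3; lra.
exists ((1 + M + C) / (alpha - 1)); first by rewrite divr_ge0 ?(ltW a1)// !addr_ge0.
move=> t tt0; rewrite ler_pdivlMr// mulrC -{1}(gtr0_norm a1) -normrZ.
have -> : (alpha - 1) *: (X t - z) = ((alpha - 1) *: (X t - z) + t *: V t) - t *: V t.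
  by rewrite addrK.
rewrite (le_trans (ler_normB _ _))// lerD//.
  by rewrite (le_trans (momentum_le t))// lerD2l EM.
by rewrite normrZ gtr0_norm ?t_gt0// VC.
Qed.

(** By Cauchy-Schwarz and boundedness of the trajectory, [|t r t| <= C t |V t| <= C sqrt (2 kinetic
    t)], which tends to zero. *)
Let cross_cvg0 : t * r t @[t --> +oo] --> 0.
Proof.
have [C C0 XC] := trajectory_bounded.
have h2 : 2 * kinetic t @[t --> +oo] --> (2 * 0 : R).
  by apply: cvgM; [exact: cvg_cst|exact: kinetic_cvg0].
have h1 : Num.sqrt (2 * kinetic t) @[t --> +oo] --> Num.sqrt (2 * 0 : R).
  apply: (cvg_comp _ _ h2); exact: sqrt_continuous.
have h : C * Num.sqrt (2 * kinetic t) @[t --> +oo] --> 0.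
  rewrite mulr0 sqrtr0 in h1.
  by rewrite -[X in _ --> X](mulr0 C); apply: cvgM; [exact: cvg_cst|].
apply: norm_cvg0; apply: (@squeeze_cvgr _ _ _ _ (cst 0) _ _ _ _ (cvg_cst _) h).
near=> t; have tt0 : t0 <= t by near: t; apply: nbhs_pinfty_ge; rewrite num_real.
have t_gt := t_gt0 tt0; rewrite normr_ge0/= normrM gtr0_norm//.
apply: (@le_trans _ _ (C * (t * `|V t|))).
  rewrite mulrCA ler_pM2l// (le_trans (cauchy_schwarz dot_norm _ _))//.
  by rewrite ler_wpM2r// XC.
rewrite ler_wpM2l// -[leLHS]ger0_norm ?mulr_ge0 ?(ltW t_gt)// -sqrtr_sqr ler_wsqrtr//.
rewrite exprMn (sqr_norm_dot dot_norm) /kinetic -/(w t).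
have : 0 <= t ^+ 2 * phi t by rewrite mulr_ge0// sqr_ge0.
by lra.
Unshelve. all: by end_near. Qed.

(** Solve the definition of [energy] for [q]: [energy] converges by dominated growth, while
    [kinetic] and the cross term vanish at infinity. *)
Lemma distance_cvg : exists l : R, `|X t - z| ^+ 2 @[t --> +oo] --> l.
Proof.
have [M M0 EM] := energy_bounded.
have [l El] : exists l : R, energy t @[t --> +oo] --> l.
  apply: (@dominated_growth_cvg _ energy (fun t => (1 + M) * (t * `|g t|)) t0 0).
  - by move=> t tt0; rewrite mulr_ge0 ?addr_ge0// g_ge0.
  - by apply: integrable_scaler; [exact: measurable_itv|exact: g_int].
  - apply: (derive_le_dominated_growth _ energy_derive).
    + by move=> t _; exact: energy_cont.
    + move=> t tt0; have t_gt : 0 < t by apply: lt_trans tt0.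
      have := energy_derive_le tt0.
      have : t * `|g t| * `|(alpha - 1) *: (X t - z) + t *: V t| <= (1 + M) * (t * `|g t|).
        rewrite mulrC; apply: ler_wpM2r; first exact: g_ge0 (ltW tt0).
        by rewrite (le_trans (momentum_le t))// lerD2l EM// ltW.
      have : 0 <= (alpha - 3) * (t * phi t).
        by rewrite mulr_ge0 ?subr_ge0 ?(ltW alpha_gt3)// mulr_ge0// ltW.
      by lra.
    + by move=> t tt0; rewrite mulr_ge0 ?addr_ge0// g_ge0.
    + by apply: integrable_scaler; [exact: measurable_itv|exact: g_int].
  - by move=> t _; exact: energy_ge0.
set k := (alpha - 1) ^+ 2 / 2.
have k0 : k != 0 by rewrite gt_eqF// divr_gt0// exprn_gt0//; have := alpha_gt3; lra.
exists (k^-1 * (l - 0 - (alpha - 1) * 0)).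
have -> : (fun t => `|X t - z| ^+ 2) =
    (fun t => k^-1 * (energy t - kinetic t - (alpha - 1) * (t * r t))).
  apply/funext => t; rewrite (sqr_norm_dot dot_norm) -/(q t) /energy -/k.
  by rewrite -[q t in LHS](mulKf k0); congr (_ * _); ring.
apply: cvgM; first exact: cvg_cst.
apply: cvgB; first by apply: cvgB; [exact: El|exact: kinetic_cvg0].
by apply: cvgM; [exact: cvg_cst|exact: cross_cvg0].
Qed.

End dynamics.

(** * Application of the estimates to the given solution *)

Lemma inf_range_argmin (T : Type) (R : realType) (f : T -> R) z :
  argmin f z -> inf (range f) = f z.
Proof.
move=> fz; have lbf : lbound (range f) (f z) by move=> _ [u _ <-]; exact: fz.
apply/eqP; rewrite eq_le; apply/andP; split.
  by apply: ge_inf; [exists (f z)|exists z].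
by apply: lb_le_inf => //; exists (f z), z.
Qed.

Theorem theorem3p1 (R : realType) (H : completeNormedModType R)
    (dot : {dot H for idfun}) (dotE : norm_of_dot dot)
    (Phi : H -> R) (gradPhi : H -> H)
    (Phi_convex : convex_function setT (Phi : convex_lmodType H -> R^o))
    (Phi_grad : is_gradient dot Phi gradPhi)
    (gradPhi_cont : continuous gradPhi)
    (argmin_neq0 : argmin Phi !=set0)
    (t0 alpha : R) (t0_gt0 : 0 < t0) (alpha_gt3 : 3 < alpha)
    (g : R -> H)
    (g_int : (@lebesgue_measure R).-integrable `[t0, +oo[
               (fun t => (t * `|g t|)%:E))
    (x : R -> H) (x_sol : classical_solution gradPhi t0 alpha g x) :
  let dx := derive_within `[t0, +oo[ x in
  (exists2 xstar, argmin Phi xstar & weakly_cvg dot x (pinfty_nbhs R) xstar) /\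
  ((exists2 C : R, 0 < C &
      forall t, t0 <= t -> Phi (x t) - inf (range Phi) <= C / t ^+ 2) /\
   (@lebesgue_measure R).-integrable `[t0, +oo[
     (fun t => (t * (Phi (x t) - inf (range Phi)))%:E)) /\
  [/\ (@lebesgue_measure R).-integrable `[t0, +oo[
        (fun t => (t * `|dx t| ^+ 2)%:E),
      exists2 C : R, 0 < C & forall t, t0 <= t -> `|dx t| <= C / t &
      `|dx t| @[t --> +oo] --> (0 : R)].
Proof.
set I := `[t0, +oo[%classic; move=> dx.
have [z z_min] := argmin_neq0.
(* These extensions of [x] and its derivative are continuous on the line and satisfy the equation,
   as a first-order system, at every [t > t0]. *)
pose X t := x (Num.max t0 t); pose V t := dx (Num.max t0 t).
have XE t : t0 <= t -> X t = x t by rewrite /X => /max_idPr ->.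
have VE t : t0 <= t -> V t = dx t by rewrite /V => /max_idPr ->.
have X_cont : continuous X by apply: extension_continuous => t /x_sol[].
have V_cont : continuous V by apply: extension_continuous => t /x_sol[].
have dX t : t0 < t -> is_derive t 1 X (V t).
  move=> tt0; rewrite VE ?ltW//; apply: extension_is_derive => //.
  by have [] := x_sol t (ltW tt0).
have dV t : t0 < t -> is_derive t 1 V (g t - (alpha / t) *: V t - gradPhi (X t)).
  move=> tt0; have [_ dxt eqt] := x_sol t (ltW tt0).
  rewrite VE ?XE ?ltW// -eqt addrAC addrK addrK.
  exact: extension_is_derive.
rewrite (inf_range_argmin z_min).
have [C C0 gapC] := value_gap_bounded dotE Phi_convex Phi_grad t0_gt0 alpha_gt3 g_int
  X_cont V_cont dX dV z_min.
have [K K0 VK] := speed_bounded dotE Phi_convex Phi_grad t0_gt0 alpha_gt3 g_int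
  X_cont V_cont dX dV z_min.
have t_gt0 t : t0 <= t -> 0 < t by exact: lt_le_trans.
(* Since [K] is only known to be nonnegative, one is added to get a positive constant. *)
have VK' t : t0 <= t -> `|dx t| <= (K + 1) / t.
  move=> tt0; rewrite ler_pdivlMr ?t_gt0// mulrC -VE// (le_trans (VK t tt0))//.
  by rewrite lerDl.
split; [|split; [split|split]].
- have [M M0 XM] := trajectory_bounded dotE Phi_convex Phi_grad t0_gt0 alpha_gt3 g_int
    X_cont V_cont dX dV z_min.
  have [|||c c_min Xc] := @opial R H dot dotE (pinfty_nbhs R) X (argmin Phi) (M + `|z|).
  + near=> t; have tt0 : t0 <= t by near: t; apply: nbhs_pinfty_ge; rewrite num_real.
    by rewrite -[X t](subrK z) (le_trans (ler_normD _ _))// lerD2r XM.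
  + move=> y y_min; exact: (distance_cvg dotE Phi_convex Phi_grad t0_gt0 alpha_gt3 g_int
      X_cont V_cont dX dV y_min).
  (* Weak cluster points are minimizers: [Phi c] plus the gradient at [c] paired with [X t - c] is
     at most [Phi (X t)], which is eventually at most [Phi z + e], and the pairing tends to zero
     along [U]. *)
  + move=> U c UU FU Xc v; apply: le_trans (z_min v).
    have PU : ProperFilter U by exact: ultra_proper.
    apply/ler_addgt0Pr => e e0.
    have lim_c : Phi c + (dot (X t) (gradPhi c) - dot c (gradPhi c)) @[t --> U] -->
        Phi c + (dot c (gradPhi c) - dot c (gradPhi c)).
      apply: cvgD; first exact: cvg_cst.
      by apply: cvgB; [exact: Xc|exact: cvg_cst].
    rewrite subrr addr0 in lim_c.
    apply: (cvgr_to_le lim_c); apply: FU; near=> t.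
    have tt0 : t0 <= t by near: t; apply: nbhs_pinfty_ge; rewrite num_real.
    (* Together with [C / e <= t], this gives [C <= e t^2], so the value gap, at most [C / t^2], is
       at most [e]. *)
    have t1 : 1 <= t by near: t; apply: nbhs_pinfty_ge; rewrite num_real.
    have tC : C / e <= t by near: t; apply: nbhs_pinfty_ge; rewrite num_real.
    have := convex_gradient_le Phi_grad c (X t) Phi_convex.
    rewrite dotDr dotNr (dot_sym dot (gradPhi c)) (dot_sym dot (gradPhi c)) => h.
    apply: (le_trans h); rewrite -lerBlDl.
    rewrite -(ler_pM2l (exprn_gt0 2 (t_gt0 t tt0))) (le_trans (gapC t tt0))//.
    by rewrite -ler_pdivrMr// (le_trans tC)// expr2 ler_peMl// ltW// t_gt0.
  exists c => // y; apply: cvg_trans (Xc y); apply: near_eq_cvg; near=> t.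
  by rewrite XE//; near: t; apply: nbhs_pinfty_ge; rewrite num_real.
- exists (C + 1); first by rewrite ltr_wpDl.
  move=> t tt0; rewrite ler_pdivlMr ?exprn_gt0 ?t_gt0// mulrC -XE//.
  by rewrite (le_trans (gapC t tt0))// lerDl.
- have := value_gap_integrable dotE Phi_convex Phi_grad t0_gt0 alpha_gt3 g_int
    X_cont V_cont dX dV z_min.
  apply: eq_integrable; first exact: measurable_itv.
  by move=> t; rewrite inE/= in_itv/= andbT => tt0; rewrite /= XE.
- have := speed_integrable dotE Phi_convex Phi_grad t0_gt0 alpha_gt3 g_int
    X_cont V_cont dX dV z_min.
  apply: eq_integrable; first exact: measurable_itv.
  by move=> t; rewrite inE/= in_itv/= andbT => tt0; rewrite /= VE.
- by exists (K + 1); [rewrite ltr_wpDl|].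
apply: (@squeeze_cvgr _ _ _ _ (cst 0) (fun t => (K + 1) * t^-1)).
- near=> t; rewrite normr_ge0/=; apply: VK'.
  by near: t; apply: nbhs_pinfty_ge; rewrite num_real.
- exact: cvg_cst.
rewrite -[X in _ --> X](mulr0 (K + 1)); apply: cvgM; first exact: cvg_cst.
apply: (gtr0_cvgV0 (f := id) _).2; last exact: cvg_id.
by apply: nbhs_pinfty_gt; rewrite num_real.
Unshelve. all: by end_near. Qed.
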